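(* (Weak Nullstellensatz) Let $\mathfrak{a}\subset\mathbb{T}[x_1,\dots,x_n]$ be a proper finitely generated tropical ideal. Then $Z_{\mathrm{tr}}(\mathfrak{a})\neq\emptyset$. Equivalently, if $\mathfrak{a}\subseteq\mathbb{T}[x_1,\dots,x_n]$ is a finitely generated tropical ideal with $Z_{\mathrm{tr}}(\mathfrak{a})=\emptyset$, then $\mathfrak{a}=\mathbb{T}[x_1,\dots,x_n]$.
   Context: Extended tropical semiring: $\mathbb{T}=\mathbb{R}\cup\{-\infty\}\cup\mathbb{R}^\nu$, where $\mathbb{R}^\nu=\{a^\nu : a\in\mathbb{R}\}$ is a disjoint copy of $\mathbb{R}$. Elements of $\mathbb{R}$ are tangible, elements of $\mathbb{U}=\mathbb{R}^\nu$ are ghost, and $\bar{\mathbb{U}}=\mathbb{U}\cup\{-\infty\}$. Put $(a^\nu)^\nu=a^\nu$ and $(-\infty)^\nu=-\infty$. Total order: $-\infty$ is the least element; for reals $a<b$ each of $a,a^\nu$ is $\prec$ each of $b,b^\nu$; and $a\prec a^\nu$. Addition: $\alpha\oplus\beta=\max_{\prec}\{\alpha,\beta\}$ if $\alpha\ne\beta$, and $\alpha\oplus\alpha=\alpha^\nu$ (so $(-\infty)\oplus(-\infty)=-\infty$). Multiplication (written $\odot$ or by juxtaposition): $a\odot b=a+b$, $a^\nu\odot b=a\odot b^\nu=a^\nu\odot b^\nu=(a+b)^\nu$ for $a,b\in\mathbb{R}$, and $-\infty$ is absorbing. This is a commutative semiring with zero $-\infty$ and unit $0$. $\mathbb{T}^{(n)}$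 is the $n$-fold Cartesian product. $\mathbb{T}[x_1,\dots,x_n]$ is the semiring of formal polynomials over $\mathbb{T}$ with usual polynomial operations; $f(\mathbf{a})$ denotes evaluation. A tropical ideal is a subset $\mathfrak{a}\subseteq\mathbb{T}[x_1,\dots,x_n]$ containing $-\infty$, closed under $\oplus$, and closed under multiplication by arbitrary elements of $\mathbb{T}[x_1,\dots,x_n]$. It is finitely generated if $\mathfrak{a}=\{\bigoplus_{i=1}^s h_if_i : h_i\in\mathbb{T}[x_1,\dots,x_n]\}$ for some $f_1,\dots,f_s$. The tropical algebraic set of $\mathfrak{a}$ is $Z_{\mathrm{tr}}(\mathfrak{a})=\{\mathbf{a}\in\mathbb{T}^{(n)} : f(\mathbf{a})\in\bar{\mathbb{U}}\ \forall f\in\mathfrak{a}\}$. *)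

(* Defs.v *)
From HB Require Import structures.
From mathcomp Require Import all_boot all_order all_algebra finmap.
From mathcomp Require Import boolp classical_sets reals.
From mathcomp Require Import mpoly.

Set Implicit Arguments.
Unset Strict Implicit.
Unset Printing Implicit Defensive.

Import Order.TTheory GRing.Theory Num.Theory.

Local Open Scope classical_set_scope.
Local Open Scope ring_scope.

(* [Tangible a] is the real number a, [Ghost a] is its copy a^nu. *)
Variant trop (R : Type) := NegInf | Tangible of R | Ghost of R.

Arguments NegInf {R}.

Section TropChoice.
Variable R : Type.

Definition trop_code (x : trop R) : option (R + R) :=
  match x with
  | NegInf => None
  | Tangible a => Some (inl a)
  | Ghost a => Some (inr a)
  end.

Definition trop_decode (x : option (R + R)) : trop R :=
  match x with
  | None => NegInf
  | Some (inl a) => Tangible a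
  | Some (inr a) => Ghost a
  end.

Lemma trop_codeK : cancel trop_code trop_decode.
Proof. by case. Qed.

End TropChoice.

HB.instance Definition _ (R : choiceType) :=
  Choice.copy (trop R) (can_type (@trop_codeK R)).

Section Trop.
Variable R : realDomainType.
Implicit Types (x y z : trop R) (a b : R).

Definition trop_nu x : trop R := if x is Tangible a then Ghost a else x.

(* The set written U-bar: the ghosts together with -oo. *)
Definition ghost_bar : set (trop R) :=
  [set x | x = NegInf \/ exists a, x = Ghost a].

Definition trop_lt x y : bool :=
  match x, y with
  | _, NegInf => false
  | NegInf, _ => true
  | Tangible a, Ghost b => a <= b
  | Tangible a, Tangible b | Ghost a, Ghost b | Ghost a, Tangible b => a < b
  end.

Definition trop_le x y : bool := (x == y) || trop_lt x y.

Fact trop_lt_def x y : trop_lt x y = (y != x) && trop_le x y.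
Proof.
rewrite /trop_le [y == x]eq_sym; case: eqP => [<-|_] //=.
by case: x => [|a|a] //=; rewrite ltxx.
Qed.

Fact trop_lt_trans : transitive trop_lt.
Proof.
move=> [|b|b] [|a|a] [|c|c] //=.
- exact: lt_trans.
- by move=> /ltW; apply: le_trans.
- exact: lt_trans.
- by move=> ab /(lt_le_trans ab).
- exact: le_lt_trans.
- by move=> ab /ltW; apply: le_trans.
- exact: lt_trans.
- exact: lt_trans.
Qed.

Fact trop_le_refl : reflexive trop_le.
Proof. by move=> x; rewrite /trop_le eqxx. Qed.

Fact trop_ltxx x : trop_lt x x = false.
Proof. by rewrite trop_lt_def eqxx. Qed.

Fact trop_le_anti : antisymmetric trop_le.
Proof.
move=> x y /andP[/orP[/eqP//|xy] /orP[/eqP//|yx]].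
by have := trop_lt_trans xy yx; rewrite trop_ltxx.
Qed.

Fact trop_le_trans : transitive trop_le.
Proof.
move=> y x z /orP[/eqP->//|xy] /orP[/eqP<-|yz].
  by rewrite /trop_le xy orbT.
by rewrite /trop_le (trop_lt_trans xy yz) orbT.
Qed.

Fact trop_le_total : total trop_le.
Proof.
rewrite /trop_le => -[|a|a] [|b|b] //=;
by have [//|//|e] := ltgtP a b; rewrite ?e ?eqxx ?orbT.
Qed.

Fact trop_display : Order.disp_t. Proof. exact: (Order.Disp tt tt). Qed.

HB.instance Definition _ := Order.isPOrder.Build trop_display (trop R)
  trop_lt_def trop_le_refl trop_le_anti trop_le_trans.
HB.instance Definition _ := Order.POrder_isTotal.Build trop_display (trop R)
  trop_le_total.

Definition trop_add x y : trop R :=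
  if x == y then trop_nu x else Order.max x y.

Definition trop_mul x y : trop R :=
  match x, y with
  | NegInf, _ | _, NegInf => NegInf
  | Tangible a, Tangible b => Tangible (a + b)
  | Tangible a, Ghost b | Ghost a, Tangible b | Ghost a, Ghost b =>
      Ghost (a + b)
  end.

(* The value at NegInf is a junk value. *)
Definition trop_val x : R := if x is Tangible a then a else
  if x is Ghost a then a else 0.

Fact trop_add0r : left_id NegInf trop_add.
Proof. by case. Qed.

Fact trop_addr0 : right_id NegInf trop_add.
Proof. by case. Qed.

Fact trop_addE x y : x != NegInf -> y != NegInf ->
  trop_add x y = if trop_val x < trop_val y then y
                 else if trop_val y < trop_val x then x else trop_nu x.
Proof.
rewrite /trop_add maxElt [(x < y)%O]/Order.lt /=.
case: x => [|a|a] //; case: y => [|b|b] //= _ _.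
- by case: eqP => [[->]|/eqP ab]; rewrite ?ltxx //; have [//|//|e] := ltgtP a b;
    rewrite e eqxx in ab.
- by have [//|//|->] := ltgtP a b.
- by have [//|//|->] := ltgtP a b.
- by case: eqP => [[->]|/eqP ab]; rewrite ?ltxx //; have [//|//|e] := ltgtP a b;
    rewrite e eqxx in ab.
Qed.

Fact trop_addC : commutative trop_add.
Proof.
move=> x y; rewrite /trop_add eq_sym.
by case: eqP => [->//|_]; rewrite maxC.
Qed.

Fact trop_nu_val x : trop_val (trop_nu x) = trop_val x.
Proof. by case: x. Qed.

Fact trop_nu_eq0 x : (trop_nu x == NegInf) = (x == NegInf).
Proof. by case: x. Qed.

Fact trop_add_eq0 x y : x != NegInf -> trop_add x y != NegInf.
Proof.
move=> x0; have [->|y0] := eqVneq y NegInf; first by rewrite trop_addr0.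
rewrite trop_addE //; case: ifP => // _; case: ifP => // _.
by rewrite trop_nu_eq0.
Qed.

Fact trop_nu_congr x y : x != NegInf -> y != NegInf ->
  trop_val x = trop_val y -> trop_nu x = trop_nu y.
Proof. by case: x => [|a|a] //; case: y => [|b|b] //= _ _ ->. Qed.

Fact trop_nuK x : trop_nu (trop_nu x) = trop_nu x.
Proof. by case: x. Qed.

Fact trop_addA : associative trop_add.
Proof.
move=> x y z.
have [->|x0] := eqVneq x NegInf; first by rewrite !trop_add0r.
have [->|y0] := eqVneq y NegInf; first by rewrite trop_add0r trop_addr0.
have [->|z0] := eqVneq z NegInf; first by rewrite !trop_addr0.
rewrite (trop_addE y0 z0) (trop_addE x0 y0).
have [yz|zy|yz] := ltgtP (trop_val y) (trop_val z);
have [xy|yx|xy] := ltgtP (trop_val x) (trop_val y);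
rewrite !trop_addE ?trop_nu_eq0 // ?trop_nu_val ?trop_nuK.
- by rewrite (lt_trans xy yz) yz.
- by rewrite xy yz.
- by rewrite xy ltNge (ltW zy) zy.
- by rewrite ltNge (ltW yx) yx /= ltNge (ltW (lt_trans zy yx)) (lt_trans zy yx).
- by rewrite -xy in zy *; rewrite ltxx ltNge (ltW zy) zy.
- by rewrite -yz xy ltxx; apply: trop_nu_congr.
- by rewrite -yz ltNge (ltW yx) yx.
- by rewrite -yz -xy ltxx.
Qed.

Fact trop_mulC : commutative trop_mul.
Proof. by move=> [|a|a] [|b|b] //=; rewrite addrC. Qed.

Fact trop_mulA : associative trop_mul.
Proof. by move=> [|a|a] [|b|b] [|c|c] //=; rewrite addrA. Qed.

Fact trop_mul1r : left_id (Tangible 0) trop_mul.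
Proof. by move=> [|a|a] //=; rewrite add0r. Qed.

Fact trop_mul0r : left_zero NegInf trop_mul.
Proof. by []. Qed.

Fact trop_mul_eq0 x y : x != NegInf -> y != NegInf -> trop_mul x y != NegInf.
Proof. by case: x => [|a|a] //; case: y. Qed.

Fact trop_mul_val x y : x != NegInf -> y != NegInf ->
  trop_val (trop_mul x y) = trop_val x + trop_val y.
Proof. by case: x => [|a|a] //; case: y. Qed.

Fact trop_mul_nu x y : trop_mul (trop_nu x) y = trop_nu (trop_mul x y).
Proof. by case: x => [|a|a] //; case: y. Qed.

Fact trop_mulDl : left_distributive trop_mul trop_add.
Proof.
move=> x y z.
have [->|z0] := eqVneq z NegInf; first by rewrite ![trop_mul _ NegInf]trop_mulC.
have [->|x0] := eqVneq x NegInf; first by rewrite !trop_add0r.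
have [->|y0] := eqVneq y NegInf; first by rewrite !trop_addr0.
rewrite !trop_addE ?trop_mul_eq0 // !trop_mul_val // !ltrD2r.
by case: ifP => // _; case: ifP => // _; rewrite trop_mul_nu.
Qed.

Fact trop_oner_neq0 : Tangible 0 != NegInf :> trop R.
Proof. by []. Qed.

(* In ring_scope, 0 is the element -oo and 1 is the real number zero. *)
HB.instance Definition _ := GRing.isNmodule.Build (trop R)
  trop_addA trop_addC trop_add0r.
HB.instance Definition _ := GRing.Nmodule_isComNzSemiRing.Build (trop R)
  trop_mulA trop_mulC trop_mul1r trop_mulDl trop_mul0r trop_oner_neq0.

End Trop.

(* The multinomials library only provides polynomials over rings, while the
   coefficients here form a mere semiring: a formal polynomial is encoded as a
   finitely supported function from exponents to coefficients. *)
Definition mvpoly (n : nat) (S : comNzSemiRingType) :=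
  {fsfun 'X_{1..n} -> S with 0}.

Section MvPoly.
Local Open Scope fset_scope.
Local Open Scope ring_scope.
Variables (n : nat) (S : comNzSemiRingType).
Implicit Types (p q r : mvpoly n S) (m k : 'X_{1..n}) (c : S).

HB.instance Definition _ := Choice.on (mvpoly n S).

Definition mvmono c m : mvpoly n S := [fsfun k in [fset m] => c].

Definition mvadd p q : mvpoly n S :=
  [fsfun m in finsupp p `|` finsupp q => p m + q m].

Definition mvzero : mvpoly n S := [fsfun for fun=> 0].

Fact mvmonoE c m k : mvmono c m k = if k == m then c else 0.
Proof. by rewrite fsfunE inE. Qed.

Fact mvzeroE m : mvzero m = 0.
Proof. by rewrite fsfunE. Qed.

Fact mvaddE p q m : mvadd p q m = p m + q m.
Proof.
rewrite fsfunE inE; case: (finsuppP p) => _; case: (finsuppP q) => _ //=.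
by rewrite addr0.
Qed.

Fact mvaddA : associative mvadd.
Proof. by move=> p q r; apply/fsfunP=> m; rewrite !mvaddE addrA. Qed.

Fact mvaddC : commutative mvadd.
Proof. by move=> p q; apply/fsfunP=> m; rewrite !mvaddE addrC. Qed.

Fact mvadd0 : left_id mvzero mvadd.
Proof. by move=> p; apply/fsfunP=> m; rewrite !mvaddE mvzeroE add0r. Qed.

HB.instance Definition _ := GRing.isNmodule.Build (mvpoly n S)
  mvaddA mvaddC mvadd0.

Fact mvcoef0 m : (0 : mvpoly n S) m = 0.
Proof. exact: mvzeroE. Qed.

Fact mvcoefD p q m : (p + q) m = p m + q m.
Proof. exact: mvaddE. Qed.

Definition mvmul p q : mvpoly n S :=
  \sum_(m <- finsupp p) \sum_(k <- finsupp q) mvmono (p m * q k) (m + k)%MM.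

Definition mvone : mvpoly n S := mvmono 1 0%MM.

Fact mvmono0 m : mvmono 0 m = 0.
Proof. by apply/fsfunP=> k; rewrite mvmonoE mvcoef0; case: ifP. Qed.

Fact mvmonoD c d m : mvmono (c + d) m = mvmono c m + mvmono d m.
Proof.
by apply/fsfunP=> k; rewrite mvcoefD !mvmonoE; case: ifP; rewrite ?addr0.
Qed.

Fact mvmulw (d1 d2 : {fset 'X_{1..n}}) p q :
    finsupp p `<=` d1 -> finsupp q `<=` d2 ->
  mvmul p q = \sum_(m <- d1) \sum_(k <- d2) mvmono (p m * q k) (m + k)%MM.
Proof.
move=> le1 le2; rewrite /mvmul (big_fset_incl _ le1) /=.
  apply: eq_bigr => m _; apply: big_fset_incl => // k _ /fsfun_dflt ->.
  by rewrite mulr0 mvmono0.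
move=> m _ /fsfun_dflt pm0.
by rewrite big1 // => k _; rewrite pm0 mul0r mvmono0.
Qed.

Fact mvsumE p : p = \sum_(m <- finsupp p) mvmono (p m) m.
Proof.
apply/fsfunP=> k.
rewrite (big_morph (fun r : mvpoly n S => r k) (id1 := 0) (op1 := +%R)
  (fun x y => mvcoefD x y k) (mvcoef0 k)).
under eq_bigr do rewrite mvmonoE.
case: finsuppP => [kp|kp].
  rewrite big_seq big1 // => m mp; case: eqP => // km.
  by rewrite km mp in kp.
rewrite (big_fsetD1 k) //= eqxx big_seq big1 ?addr0 // => m.
by rewrite !inE => /andP[/negPf mk _]; rewrite eq_sym mk.
Qed.

Fact mvmono_supp c m : finsupp (mvmono c m) `<=` [fset m].
Proof. exact: finsupp_sub. Qed.

Fact mvmulC : commutative mvmul.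
Proof.
move=> p q; rewrite /mvmul exchange_big /=.
by apply: eq_bigr => m _; apply: eq_bigr => k _; rewrite mulrC addmC.
Qed.

Fact mvmul0r : left_zero 0 mvmul.
Proof.
move=> p; rewrite /mvmul big1 // => m _.
by rewrite big1 // => k _; rewrite mvcoef0 mul0r mvmono0.
Qed.

Fact mvmulr0 : right_zero 0 mvmul.
Proof. by move=> p; rewrite mvmulC mvmul0r. Qed.

Fact mvmul1r : left_id mvone mvmul.
Proof.
move=> p; rewrite (mvmulw (@mvmono_supp _ _) (fsubset_refl _)).
rewrite big_seq_fset1 [RHS]mvsumE; apply: eq_bigr => m _.
by rewrite mvmonoE eqxx mul1r add0m.
Qed.

Fact mvmulDl : left_distributive mvmul +%R.
Proof.
move=> p q r; have supD : finsupp (p + q) `<=` finsupp p `|` finsupp q.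
  exact: finsupp_sub.
rewrite (mvmulw supD (fsubset_refl _)).
rewrite (mvmulw (fsubsetUl _ (finsupp q)) (fsubset_refl (finsupp r))).
rewrite (mvmulw (fsubsetUr (finsupp p) _) (fsubset_refl (finsupp r))).
rewrite -big_split /=; apply: eq_bigr => m _.
rewrite -big_split /=; apply: eq_bigr => k _.
by rewrite mvcoefD mulrDl mvmonoD.
Qed.

Fact mvmulDr : right_distributive mvmul +%R.
Proof. by move=> p q r; rewrite mvmulC mvmulDl !(mvmulC _ p). Qed.

Fact mvmulMM c d m k : mvmul (mvmono c m) (mvmono d k) = mvmono (c * d) (m + k)%MM.
Proof.
rewrite (mvmulw (@mvmono_supp _ _) (@mvmono_supp _ _)) !big_seq_fset1.
by rewrite !mvmonoE !eqxx.
Qed.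

Fact mvmul_suml (I : Type) (s : seq I) (F : I -> mvpoly n S) p :
  mvmul (\sum_(i <- s) F i) p = \sum_(i <- s) mvmul (F i) p.
Proof.
exact: (big_morph (mvmul^~ p) (fun x y => mvmulDl x y p) (mvmul0r p)).
Qed.

Fact mvmul_sumr (I : Type) (s : seq I) (F : I -> mvpoly n S) p :
  mvmul p (\sum_(i <- s) F i) = \sum_(i <- s) mvmul p (F i).
Proof.
exact: (big_morph (mvmul p) (mvmulDr p) (mvmulr0 p)).
Qed.

Fact mvmulA : associative mvmul.
Proof.
move=> p q r; rewrite [p]mvsumE [q]mvsumE [r]mvsumE.
move: (finsupp p) (finsupp q) (finsupp r) => dp dq dr.
rewrite !mvmul_suml; apply: eq_bigr => m _.
rewrite mvmul_sumr [X in _ = mvmul X _]mvmul_sumr mvmul_suml.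
apply: eq_bigr => k _.
rewrite !mvmul_sumr; apply: eq_bigr => l _.
by rewrite !mvmulMM mulrA addmA.
Qed.

Fact mvoner_neq0 : mvone != 0.
Proof.
apply/eqP => /fsfunP/(_ 0%MM)/eqP.
by rewrite mvmonoE eqxx mvcoef0 oner_eq0.
Qed.

HB.instance Definition _ := GRing.Nmodule_isComNzSemiRing.Build (mvpoly n S)
  mvmulA mvmulC mvmul1r mvmulDl mvmul0r mvoner_neq0.

Definition mveval p (v : {ffun 'I_n -> S}) : S :=
  \sum_(m <- finsupp p) p m * \prod_(i < n) v i ^+ m i.

End MvPoly.

Section Ideals.
Variables (R : realDomainType) (n : nat).
Local Notation poly := (mvpoly n (trop R)).
Implicit Types I : set poly.

Definition tropical_ideal I : Prop :=
  [/\ I 0,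
      forall f g, I f -> I g -> I (f + g)
    & forall h f, I f -> I (h * f)].

Definition finitely_generated I : Prop :=
  exists (s : nat) (f : 'I_s -> poly),
    I = [set g | exists h : 'I_s -> poly, g = \sum_(i < s) h i * f i].

Definition tropical_zeros I : set {ffun 'I_n -> trop R} :=
  [set v | forall f, I f -> ghost_bar (mveval f v)].

End Ideals.

(* Main.v *)
(** A nonzero tangible constant is a unit, so no generator of a proper ideal is
    one, and a common zero can be found far out on the ghost diagonal: at
    (a^nu, ..., a^nu) every nonconstant monomial takes a value in U-bar, and for
    [a] large a nonconstant term of each generator dominates its constant term. *)
Require Import Defs.
From HB Require Import structures.
From mathcomp Require Import all_boot all_order all_algebra finmap.
From mathcomp Require Import boolp classical_sets reals.
From mathcomp Require Import mpoly.

Import Order.TTheory GRing.Theory Num.Theory.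

Local Open Scope classical_set_scope.
Local Open Scope ring_scope.

Section Evaluation.
Local Open Scope fset_scope.
Local Open Scope ring_scope.
Context {n : nat} {S : comNzSemiRingType} {v : {ffun 'I_n -> S}}.
Implicit Types p q : mvpoly n S.

(** Lets evaluations of polynomials with different supports be compared over one index set. *)
Lemma mvevalw {d : {fset 'X_{1..n}}} {p} : finsupp p `<=` d ->
  mveval p v = \sum_(m <- d) p m * \prod_(i < n) v i ^+ m i.
Proof.
move=> pd; rewrite /mveval (big_fset_incl _ pd) //= => m _ /fsfun_dflt ->.
by rewrite mul0r.
Qed.

Lemma mveval0 : mveval 0 v = 0 :> S.
Proof. by rewrite /mveval big1 // => m _; rewrite mvcoef0 mul0r. Qed.

Lemma mvevalD p q : mveval (p + q) v = mveval p v + mveval q v.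
Proof.
have supD : finsupp (p + q) `<=` finsupp p `|` finsupp q by exact: finsupp_sub.
rewrite (mvevalw supD) (mvevalw (fsubsetUl _ (finsupp q))).
rewrite (mvevalw (fsubsetUr (finsupp p) _)) -big_split /=.
by apply: eq_bigr => m _; rewrite mvcoefD mulrDl.
Qed.

Lemma mveval_sum (J : Type) (s : seq J) (F : J -> mvpoly n S) :
  mveval (\sum_(j <- s) F j) v = \sum_(j <- s) mveval (F j) v.
Proof. exact: (big_morph (fun p => mveval p v) mvevalD mveval0). Qed.

Lemma mveval_mono (c : S) (m : 'X_{1..n}) :
  mveval (mvmono c m) v = c * \prod_(i < n) v i ^+ m i.
Proof. by rewrite (mvevalw (mvmono_supp _ _)) big_seq_fset1 mvmonoE eqxx. Qed.

Lemma mvevalM p q : mveval (p * q) v = mveval p v * mveval q v.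
Proof.
rewrite {1}/GRing.mul /= /mvmul mveval_sum [RHS]mulr_suml.
apply: eq_bigr => m _; rewrite mveval_sum mulr_sumr.
apply: eq_bigr => k _; rewrite mveval_mono mulrACA -big_split /=.
by congr (_ * _); apply: eq_bigr => i _; rewrite mnmDE exprD.
Qed.

End Evaluation.

Section GhostDiagonal.
Variable R : realDomainType.
Implicit Types (a b : R) (x y : trop R).

(** Multiplication by [Ghost 0] is the map nu, so U-bar is its fixed set; closure under sums and
    multiples then follows from the semiring laws. *)
Lemma ghost_barE x : ghost_bar x <-> Ghost 0 * x = x.
Proof.
rewrite /GRing.mul /=; case: x => [|a|a] /=; rewrite ?add0r; split=> //.
- by left.
- by case=> // -[].
- by right; exists a.
Qed.

Lemma ghost_barD x y : ghost_bar x -> ghost_bar y -> ghost_bar (x + y).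
Proof. by rewrite !ghost_barE mulrDr => -> ->. Qed.

Lemma ghost_barMl x y : ghost_bar y -> ghost_bar (x * y).
Proof. by rewrite !ghost_barE mulrCA => ->. Qed.

Lemma ghost_bar_sum (J : eqType) (s : seq J) (P : pred J) (F : J -> trop R) :
  (forall j, j \in s -> P j -> ghost_bar (F j)) ->
  ghost_bar (\sum_(j <- s | P j) F j).
Proof.
by move=> gF; rewrite big_seq_cond; elim/big_ind: _ => [||j /andP[]];
  [left | exact: ghost_barD | exact: gF].
Qed.

Lemma ghost_expS a k : Ghost a ^+ k.+1 = Ghost (a *+ k.+1) :> trop R.
Proof. by elim: k => // k IH; rewrite exprS IH [in RHS]mulrS. Qed.

(** The sum is [Ghost b] in every case: a smaller [x] is absorbed, and a tie in real value produces
    a ghost. *)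
Lemma ghost_bar_dominated x b : trop_val x <= b -> ghost_bar (x + Ghost b).
Proof.
have [->|x0 xb] := eqVneq x NegInf; first by rewrite add0r; right; exists b.
right; exists b; rewrite /GRing.add /= trop_addE //=.
have [//|/(le_lt_trans xb)|] := ltgtP (trop_val x) b; first by rewrite ltxx.
by case: x x0 {xb} => [|c|c] //= _ ->.
Qed.

(** For [m] zero the empty product would be the tangible unit; a positive degree brings in at least
    one ghost factor. *)
Lemma mnm_ghost (n : nat) (m : 'X_{1..n}) a : m != 0%MM ->
  \prod_(i < n) [ffun=> Ghost a] i ^+ m i = Ghost (a *+ mdeg m) :> trop R.
Proof.
rewrite -mdeg_eq0 => m0; under eq_bigr do rewrite ffunE.
by rewrite -expr_sum -mdegE; case: (mdeg m) m0 => // k _; exact: ghost_expS.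
Qed.

Lemma mveval_ghost_diag {n : nat} (f : mvpoly n (trop R)) :
    (forall c, f <> mvmono (Tangible c) 0%MM) ->
  exists A, forall a, A <= a -> ghost_bar (mveval f [ffun=> Ghost a]).
Proof.
move=> nf; have [[m [mf m0]]|f0] :=
  pselect (exists m, m \in finsupp f /\ m != 0%MM).
  (* The absolute value also forces [a] to be nonnegative, so [a *+ mdeg m] is at least [a]. If
     [f 0%MM] is -oo, its default value 0 only alters the threshold. *)
  exists `|trop_val (f 0%MM) - trop_val (f m)| => a Aa.
  (* The zero exponent is adjoined so that a constant term, possibly -oo, can always be split
     off. *)
  rewrite (mvevalw (d := (0%MM |` finsupp f)%fset)) ?fsubsetU1 //.
  rewrite (big_fsetD1 0%MM) ?fset1U1 //= (big_fsetD1 m) /=; last first.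
    by rewrite in_fsetD1 m0 in_fset1U mf orbT.
  rewrite [X in _ * X + _]big1 ?mulr1 => [|i _]; last by rewrite mnm0E.
  (* The constant term is paired with the term at [m]; every other term is already in U-bar. *)
  rewrite addrA; apply: ghost_barD; last first.
    apply: ghost_bar_sum => k; rewrite !inE => /and3P[_ k0 _] _.
    by rewrite mnm_ghost //; apply: ghost_barMl; right; exists (a *+ mdeg k).
  rewrite mnm_ghost //.
  have -> : f m * Ghost (a *+ mdeg m) = Ghost (trop_val (f m) + a *+ mdeg m).
    by move: mf; rewrite mem_finsupp; case: (f m).
  apply: ghost_bar_dominated; rewrite -lerBlDl.
  rewrite (le_trans (ler_norm _)) // (le_trans Aa) //.
  have a0 : 0 <= a by exact: le_trans Aa.
  move: m0; rewrite -mdeg_eq0; case: (mdeg m) => // k _.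
  by rewrite mulrS lerDl mulrn_wge0.
(* Here [f] is constant, and since tangible constants are excluded its value lies in U-bar. *)
exists 0 => a _; have fE : f = mvmono (f 0%MM) 0%MM.
  apply/fsfunP => k; rewrite mvmonoE; case: eqP => [->//|/eqP k0].
  by apply/fsfun_dflt/negP => kf; apply: f0; exists k.
rewrite fE mveval_mono mulrC; apply: ghost_barMl.
case: (f 0%MM) fE => [|c|c] fE; first by left.
  by case: (nf c).
by right; exists c.
Qed.
End GhostDiagonal.

(** Tropical multiplication adds real values, so the constant [- c] is the inverse of [c]. *)
Lemma tropical_ideal_tangible {R : realDomainType} {n : nat}
    {I : set (mvpoly n (trop R))} {c : R} :
  tropical_ideal I -> I (mvmono (Tangible c) 0%MM) -> I = setT.
Proof.
case=> _ _ IM Ic; rewrite -subTset => g _.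
have -> : g = g * mvmono (Tangible (- c)) 0%MM * mvmono (Tangible c) 0%MM.
  rewrite -mulrA [X in _ * X]mvmulMM addm0 -{1}[g]mulr1; congr (_ * mvmono _ _).
  by rewrite /GRing.mul /= addNr.
exact: IM.
Qed.

Theorem theorem5p3 (R : realType) (n : nat) (I : set (mvpoly n (trop R)))
    (idealI : tropical_ideal I) (fgI : finitely_generated I) :
  (I <> setT -> tropical_zeros I <> set0) /\
  (tropical_zeros I = set0 -> I = setT).
Proof.
suff [->|[v Zv]] : I = setT \/ exists v, tropical_zeros I v.
- by split.
- by split=> [_|] Z0; rewrite Z0 in Zv.
have [s [f If]] := fgI.
have [[i [c fic]]|nf] := pselect (exists i c, f i = mvmono (Tangible c) 0%MM).
  left; apply: (tropical_ideal_tangible (c := c) idealI).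
  (* Kronecker delta coefficients show that the generator [f i] itself lies in the ideal. *)
  rewrite -fic If /=; exists (fun j => if j == i then 1 else 0).
  rewrite (bigD1 i) //= eqxx mul1r big1 ?addr0 // => j /negPf ->.
  by rewrite mul0r.
right.
have /choice[A gA] i : exists A, forall a, A <= a ->
    ghost_bar (mveval (f i) [ffun=> Ghost a]).
  by apply: mveval_ghost_diag => c fic; apply: nf; exists i, c.
(* The sum of absolute values exceeds or equals every threshold [A i], so one diagonal point serves
   all generators. *)
exists [ffun=> Ghost (\sum_i `|A i|)] => g; rewrite If => -[h ->].
rewrite mveval_sum; apply: ghost_bar_sum => i _ _; rewrite mvevalM.
apply/ghost_barMl/gA; rewrite (bigD1 i) //=.
by rewrite (le_trans (ler_norm _)) // lerDl sumr_ge0.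
Qed.
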